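(* Let $A,B:\mathfrak{X}(M)\to\mathfrak{X}(M)$ be two commuting semisimple Haantjes operators on a differentiable manifold $M$. They generate a Haantjes module if and only if $$\mathcal{H}_{A,B}(X,Y)=0\qquad\text{for all }X,Y\in\mathfrak{X}(M).$$
   Context: $M$ is a smooth manifold, $\mathfrak{X}(M)$ its smooth vector fields. An operator is a smooth $(1,1)$ tensor field $A:\mathfrak{X}(M)\to\mathfrak{X}(M)$. An operator is semisimple if it admits local reference frames (not necessarily coordinate frames, nor integrable) in which it takes a diagonal form. Nijenhuis torsion: $\tau_A(X,Y)=A^2[X,Y]+[AX,AY]-A([X,AY]+[AX,Y])$. Haantjes torsion: $\mathcal{H}_A(X,Y)=A^2\tau_A(X,Y)+\tau_A(AX,AY)-A(\tau_A(X,AY)+\tau_A(AX,Y))$. $A$ is a Haantjes operator if $\mathcal{H}_A\equiv0$. $A$ and $B$ generate a Haantjes module if $\mathcal{H}_{fA+gB}\equiv 0$ for all $f,g\in C^\infty(M)$. Frölicher–Nijenhuis bracket: $\llbracket A,B\rrbracket(X,Y)=(AB+BA)[X,Y]+[AX,BY]+[BX,AY]-A([X,BY]+[BX,Y])-B([X,AY]+[AX,Y])$. Haantjes bracket (of level 2): with $N:=\llbracket A,B\rrbracket$, $$\mathcal{H}_{A,B}(X,Y)=(AB+BA)N(X,Y)+N(AX,BY)+N(BX,AY)-A\big(N(X,BY)+N(BX,Y)\big)-B\big(N(X,AY)+N(AX,Y)\big).$$ *)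

(* Defs.v *)
(* MathComp-Analysis development, over an arbitrary R : realType. *)
From HB Require Import structures.
From mathcomp Require Import all_boot all_order all_algebra.
From mathcomp Require Import all_classical all_reals all_analysis.
From mathcomp Require Import ring.

Set Implicit Arguments.
Unset Strict Implicit.
Unset Printing Implicit Defensive.

Import Order.TTheory GRing.Theory Num.Theory.
Import numFieldNormedType.Exports.

Local Open Scope classical_set_scope.
Local Open Scope ring_scope.

Section SmoothMaps.
Context {R : realType}.
Implicit Types V W : normedModType R.

(* Intended for U open and V finite-dimensional, where asking for Fréchet
   differentiability and C^k directional derivatives in every direction is the
   usual notion of a C^(k+1) map. *)
Fixpoint Ck_on V W (k : nat) (U : set V) (f : V -> W) : Prop :=
  if k is k'.+1 then
    (forall x, U x -> differentiable f x) /\ (forall v, Ck_on k' U ('D_v f))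
  else forall x, U x -> {for x, continuous f}.

Definition Cinf_on V W (U : set V) (f : V -> W) : Prop :=
  forall k, Ck_on k U f.

(* The lemmas on C^k maps below are only used to equip smooth functions, tangent
   vectors and vector fields with their algebraic structures. *)
Lemma near_eq_differentiable V W (f g : V -> W) (x : V) :
  {near nbhs x, f =1 g} -> differentiable f x -> differentiable g x.
Proof.
move=> fg df.
have gE : g \o shift x = cst (g x) + 'd f x +o_ 0 id.
  apply/eqaddoP => _/posnumP[e].
  have /eqaddoP/(_ e%:num (gt0 e)) := diff_locally df.
  have fgx := nbhs_singleton fg.
  have : \forall h \near nbhs (0 : V), f (h + x) = g (h + x).
    have : \forall y \near x, f y = g y by exact: fg.
    by rewrite (near_shift 0 x); apply: filterS => y /=; rewrite subr0.
  by apply: filterS2 => h /= E; rewrite !fctE /= E fgx.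
have dE := diff_unique (diff_continuous df) gE.
by apply/diff_locallyP; rewrite dE; split => //; exact: diff_continuous.
Qed.

Lemma Ck_on_eq V W k (U : set V) (f g : V -> W) :
  open U -> (forall x, U x -> f x = g x) -> Ck_on k U f -> Ck_on k U g.
Proof.
move=> oU; elim: k f g => [|k IH] f g fg /=.
  move=> fC x Ux.
  have E : {near nbhs x, f =1 g}.
    by have : nbhs x U by [exact: open_nbhs_nbhs]; apply: filterS => y /fg.
  have := fC x Ux; rewrite /prop_for /continuous_at (fg _ Ux).
  by apply: cvg_trans; apply: near_eq_cvg.
have E x : U x -> {near nbhs x, f =1 g}.
  by move=> Ux; have : nbhs x U by [exact: open_nbhs_nbhs]; apply: filterS => y /fg.
move=> [fD fC]; split=> [x Ux|v]; first exact: near_eq_differentiable (E x Ux) (fD x Ux).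
apply: IH (fC v) => x Ux.
have [->|v0] := eqVneq v 0; first by rewrite !derive0.
exact: near_eq_derive (E x Ux).
Qed.

Lemma Ck_on_cst V W k (U : set V) (a : W) : Ck_on k U (cst a : V -> W).
Proof.
elim: k a => [|k IH] a /=; first by move=> x _; exact: cst_continuous.
split=> [x _|v]; first exact: differentiable_cst.
by have -> : 'D_v (cst a : V -> W) = cst 0 by apply/funext => x; exact: derive_cst.
Qed.

Lemma Ck_on_le V W k (U : set V) (f : V -> W) : Ck_on k.+1 U f -> Ck_on k U f.
Proof.
elim: k f => [|k IH] f [fD fC] /=.
  by move=> x /fD; exact: differentiable_continuous.
by split=> // v; exact: IH.
Qed.

Lemma Ck_onD V W k (U : set V) (f g : V -> W) : open U ->
  Ck_on k U f -> Ck_on k U g -> Ck_on k U (f \+ g).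
Proof.
move=> oU; elim: k f g => [|k IH] f g /=.
  by move=> fC gC x Ux; apply: continuousD; [exact: fC|exact: gC].
move=> [fD fC] [gD gC]; split=> [x Ux|v].
  by apply: differentiableD; [exact: fD|exact: gD].
apply: Ck_on_eq (IH _ _ (fC v) (gC v)) => // x Ux /=.
by rewrite -deriveD //; apply: diff_derivable; [exact: fD|exact: gD].
Qed.

Lemma Ck_onM V k (U : set V) (f g : V -> R) : open U ->
  Ck_on k U f -> Ck_on k U g -> Ck_on k U (f \* g).
Proof.
move=> oU; elim: k f g => [|k IH] f g.
  by move=> fC gC x Ux; apply: continuousM; [exact: fC|exact: gC].
move=> fS gS; have [fD fC] := fS; have [gD gC] := gS; split=> [x Ux|v].
  by apply: differentiableM; [exact: fD|exact: gD].
apply: Ck_on_eq (Ck_onD oU (IH _ _ (Ck_on_le fS) (gC v))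
                           (IH _ _ (Ck_on_le gS) (fC v))) => // x Ux /=.
by rewrite deriveM //; apply: diff_derivable; [exact: fD|exact: gD].
Qed.

End SmoothMaps.

(* chart_map is only meaningful on chart_dom, and chart_inv on the image of
   chart_dom; both are total functions for convenience. *)
Record chart (R : realType) (n : nat) (T : topologicalType) := Chart {
  chart_dom : set T;
  chart_map :> T -> 'rV[R]_n;
  chart_inv : 'rV[R]_n -> T;
  chart_dom_open : open chart_dom;
  chart_img_open : open (chart_map @` chart_dom);
  chart_mapK : forall p, chart_dom p -> chart_inv (chart_map p) = p;
  chart_map_continuous : {within chart_dom, continuous chart_map};
  chart_inv_continuous :
    {within chart_map @` chart_dom, continuous chart_inv} }.

(* The atlas need not be maximal: it represents the smooth structure that it
   generates. *)
Record manifold (R : realType) (n : nat) := Manifold {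
  manifold_space :> topologicalType;
  atlas : set (chart R n manifold_space);
  manifold_hausdorff : hausdorff_space manifold_space;
  manifold_second_countable : @second_countable manifold_space;
  atlas_cover : forall p, exists2 c, atlas c & chart_dom c p;
  atlas_compat : forall c d, atlas c -> atlas d ->
    Cinf_on (c @` (chart_dom c `&` chart_dom d)) (d \o chart_inv c) }.

Section SmoothFunctions.
Context {R : realType} {n : nat} (M : manifold R n).

(* For U open: smoothness of f on U read in every chart of the atlas. *)
Definition smooth_on (U : set M) (f : M -> R) : Prop :=
  forall c, atlas c -> Cinf_on (c @` (chart_dom c `&` U)) (f \o chart_inv c).

Definition smooth_pred : {pred M -> R^o} := fun f => `[< smooth_on setT f >].

Record Cinf := MkCinf {
  Cinf_fun :> M -> R^o;
  Cinf_subproof : Cinf_fun \in smooth_pred }.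

HB.instance Definition _ := [isSub for Cinf_fun].
HB.instance Definition _ := [Choice of Cinf by <:].

Lemma smooth_on_cst (U : set M) (a : R) : smooth_on U (fun=> a).
Proof. by move=> c _ k; exact: Ck_on_cst. Qed.

Lemma chart_setT_open (c : chart R n M) : open (c @` (chart_dom c `&` setT)).
Proof. by rewrite setIT; exact: chart_img_open. Qed.

Lemma smoothD (f g : M -> R) :
  smooth_on setT f -> smooth_on setT g -> smooth_on setT (f \+ g).
Proof.
move=> fS gS c ac k.
have := @Ck_onD R _ _ k _ (f \o chart_inv c) (g \o chart_inv c).
by apply; [exact: chart_setT_open|exact: fS|exact: gS].
Qed.

Lemma smoothM (f g : M -> R) :
  smooth_on setT f -> smooth_on setT g -> smooth_on setT (f \* g).
Proof.
move=> fS gS c ac k.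
have := @Ck_onM R _ k _ (f \o chart_inv c) (g \o chart_inv c).
by apply; [exact: chart_setT_open|exact: fS|exact: gS].
Qed.

Lemma smoothN (f : M -> R) : smooth_on setT f -> smooth_on setT (\- f).
Proof.
move=> fS; have -> : \- f = (fun=> -1) \* f by apply/funext => p /=; rewrite mulN1r.
exact: smoothM (smooth_on_cst _ _) fS.
Qed.

Fact smooth_subring : subring_closed smooth_pred.
Proof.
split=> [|f g /asboolP fS /asboolP gS|f g /asboolP fS /asboolP gS]; apply/asboolP.
- exact: smooth_on_cst.
- exact: smoothD fS (smoothN gS).
- exact: smoothM.
Qed.

Fact smooth_scaler : scaler_closed smooth_pred.
Proof.
move=> a f /asboolP fS; apply/asboolP.
exact: smoothM (smooth_on_cst _ a) fS.
Qed.

HB.instance Definition _ :=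
  GRing.isSubringClosed.Build (M -> R^o) smooth_pred smooth_subring.
HB.instance Definition _ :=
  GRing.isScaleClosed.Build R (M -> R^o) smooth_pred smooth_scaler.
HB.instance Definition _ :=
  GRing.SubChoice_isSubComPzRing.Build (M -> R^o) smooth_pred Cinf smooth_subring.
HB.instance Definition _ := [SubZmodule_isSubLmodule of Cinf by <:].
End SmoothFunctions.

Arguments smooth_pred {R n} M _.

Section VectorFields.
Context {R : realType} {n : nat} (M : manifold R n).

(* Tangent vectors at p are the point derivations at p of the algebra of smooth
   functions on M. *)
Definition is_tangent (p : M) (v : Cinf M -> R^o) : Prop :=
  scalar v /\ forall f g : Cinf M, v (f * g) = v f * g p + f p * v g.

Definition tangent_pred (p : M) : {pred Cinf M -> R^o} :=
  fun v => `[< is_tangent p v >].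

Record tangent (p : M) := MkTangent {
  tangent_fun :> Cinf M -> R^o;
  tangent_subproof : tangent_fun \in tangent_pred p }.

HB.instance Definition _ (p : M) := [isSub for @tangent_fun p].
HB.instance Definition _ (p : M) := [Choice of tangent p by <:].

Fact tangent_submod (p : M) : submod_closed (tangent_pred p).
Proof.
split=> [|a u v /asboolP[ul uM] /asboolP[vl vM]]; apply/asboolP; split.
- by move=> a f g; change ((0 : R) = a * 0 + 0); rewrite mulr0 addr0.
- by move=> f g; change ((0 : R) = 0 * g p + f p * 0); rewrite mul0r mulr0 addr0.
- move=> b f g.
  change (a * u (b *: f + g) + v (b *: f + g) =
          b * (a * u f + v f) + (a * u g + v g)).
  by rewrite ul vl; ring.
- move=> f g.
  change (a * u (f * g) + v (f * g) =
          (a * u f + v f) * g p + f p * (a * u g + v g)).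
  by rewrite uM vM; ring.
Qed.

HB.instance Definition _ (p : M) :=
  GRing.isSubmodClosed.Build R (Cinf M -> R^o) (tangent_pred p)
    (tangent_submod p).
HB.instance Definition _ (p : M) := [SubChoice_isSubLmodule of tangent p by <:].

Lemma tangentP p (v : tangent p) : is_tangent p v.
Proof. exact/asboolP/(tangent_subproof v). Qed.

(* With U = setT this defines global smooth vector fields; for an arbitrary open
   U it defines smooth vector fields on U, the values outside U being junk. *)
Definition smooth_section (U : set M) (X : forall p, tangent p) : Prop :=
  forall f : Cinf M, smooth_on U (fun p => X p f).

Record vfield := MkVfield {
  vfield_at :> forall p : M, tangent p;
  vfield_smooth : smooth_section setT vfield_at }.

Lemma vfieldP (X Y : vfield) : (forall p f, X p f = Y p f) -> X = Y.
Proof.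
case: X Y => [X Xs] [Y Ys] /= XY.
have {}XY : X = Y.
  by apply: functional_extensionality_dep => p; apply/val_inj/funext => f; exact: XY.
by subst Y; congr MkVfield; exact: Prop_irrelevance.
Qed.

HB.instance Definition _ := gen_eqMixin vfield.
HB.instance Definition _ := gen_choiceMixin vfield.

Fact vfield0_smooth : smooth_section setT (fun p => 0 : tangent p).
Proof. by move=> f; exact: smooth_on_cst. Qed.
Definition vfield0 := MkVfield vfield0_smooth.

Fact vfieldN_smooth (X : vfield) : smooth_section setT (fun p => - X p).
Proof. by move=> f; exact: smoothN (vfield_smooth X f). Qed.
Definition vfieldN X := MkVfield (vfieldN_smooth X).

Fact vfieldD_smooth (X Y : vfield) : smooth_section setT (fun p => X p + Y p).
Proof. by move=> f; exact: smoothD (vfield_smooth X f) (vfield_smooth Y f). Qed.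
Definition vfieldD X Y := MkVfield (vfieldD_smooth X Y).

Fact vfieldA : associative vfieldD.
Proof. by move=> X Y Z; apply: vfieldP => p f /=; rewrite addrA. Qed.
Fact vfieldC : commutative vfieldD.
Proof. by move=> X Y; apply: vfieldP => p f /=; rewrite addrC. Qed.
Fact vfield_add0 : left_id vfield0 vfieldD.
Proof. by move=> X; apply: vfieldP => p f /=; rewrite add0r. Qed.
Fact vfield_addN : left_inverse vfield0 vfieldN vfieldD.
Proof. by move=> X; apply: vfieldP => p f /=; rewrite addNr. Qed.

HB.instance Definition _ := GRing.isZmodule.Build vfield
  vfieldA vfieldC vfield_add0 vfield_addN.

Fact vfield_app_subproof (X : vfield) (f : Cinf M) :
  (fun p => X p f : R^o) \in smooth_pred M.
Proof. exact/asboolP/vfield_smooth. Qed.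
Definition vfield_app (X : vfield) (f : Cinf M) : Cinf M :=
  MkCinf (vfield_app_subproof X f).

Definition bracket_fun (X Y : vfield) (p : M) (f : Cinf M) : R^o :=
  X p (vfield_app Y f) - Y p (vfield_app X f).

Fact bracket_subproof (X Y : vfield) (p : M) :
  bracket_fun X Y p \in tangent_pred p.
Proof.
have appL (Z : vfield) a f g :
    vfield_app Z (a *: f + g) = a *: vfield_app Z f + vfield_app Z g.
  by apply/val_inj/funext => q; exact: (tangentP (Z q)).1.
have appM (Z : vfield) f g :
    vfield_app Z (f * g) = vfield_app Z f * g + f * vfield_app Z g.
  by apply/val_inj/funext => q; exact: (tangentP (Z q)).2.
have tD (v : tangent p) f g : v (f + g) = v f + v g.
  by have := (tangentP v).1 1 f g; rewrite scale1r mul1r.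
have tM (v : tangent p) := (tangentP v).2.
apply/asboolP; split=> [a f g|f g]; rewrite /bracket_fun.
  by rewrite !appL !(tangentP _).1; ring.
rewrite !appM !tD !tM /=.
by ring.
Qed.

Fact bracket_smooth (X Y : vfield) :
  smooth_section setT (fun p => MkTangent (bracket_subproof X Y p)).
Proof.
move=> f; apply: smoothD (smoothN _); exact: vfield_smooth.
Qed.

Definition lie_bracket (X Y : vfield) : vfield := MkVfield (bracket_smooth X Y).

End VectorFields.

Local Notation "[ 'Lie' X , Y ]" := (lie_bracket X Y) (at level 0) : ring_scope.

Section Operators.
Context {R : realType} {n : nat} (M : manifold R n).

(* Smooth (1,1) tensor fields: fibrewise endomorphisms of the tangent spaces
   mapping smooth vector fields to smooth vector fields. The coercion op_app is
   the induced map on smooth vector fields. *)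
Record operator := MkOperator {
  op_at : forall p : M, {linear tangent p -> tangent p};
  op_smooth : forall X : vfield M,
    smooth_section setT (fun p => op_at p (X p)) }.

Definition op_app (A : operator) (X : vfield M) : vfield M :=
  MkVfield (op_smooth A X).

Coercion op_app : operator >-> Funclass.

Fact op_comb_smooth (f g : Cinf M) (A B : operator) (X : vfield M) :
  smooth_section setT (fun p => (f p \*: op_at A p \+ g p \*: op_at B p) (X p)).
Proof.
move=> h; apply: smoothD; apply: smoothM; last exact: op_smooth.
- exact/asboolP/(Cinf_subproof f).
- exact: op_smooth.
- exact/asboolP/(Cinf_subproof g).
Qed.

Definition op_comb (f : Cinf M) (A : operator) (g : Cinf M) (B : operator) :=
  MkOperator (op_comb_smooth f g A B).

(* The E i are smooth on U and form a basis of the tangent space at each point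
   of U; no commutation of the E i is required. *)
Definition local_frame (U : set M) (E : 'I_n -> forall p : M, tangent p) :=
  (forall i, smooth_section U (E i)) /\
  (forall p, U p -> forall v : tangent p,
     exists! c : 'rV[R]_n, v = \sum_(i < n) c 0 i *: E i p).

(* Smoothness of the eigenvalues lambda i on U is not required since it follows
   from that of A and of the frame. *)
Definition semisimple (A : operator) : Prop :=
  forall p0 : M, exists U : set M, [/\ open U, U p0 &
    exists E (lambda : 'I_n -> M -> R), local_frame U E /\
      forall i p, U p -> op_at A p (E i p) = lambda i p *: E i p].

Implicit Types (A B : operator) (X Y : vfield M).

Definition nijenhuis_torsion A X Y : vfield M :=
  A (A [Lie X, Y]) + [Lie A X, A Y] - A ([Lie X, A Y] + [Lie A X, Y]).

Definition haantjes_torsion A X Y : vfield M :=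
  let tau := nijenhuis_torsion A in
  A (A (tau X Y)) + tau (A X) (A Y) - A (tau X (A Y) + tau (A X) Y).

Definition haantjes A : Prop := forall X Y, haantjes_torsion A X Y = 0.

Definition haantjes_module A B : Prop :=
  forall f g : Cinf M, haantjes (op_comb f A g B).

Definition frolicher_nijenhuis_bracket A B X Y : vfield M :=
  (A (B [Lie X, Y]) + B (A [Lie X, Y])) + [Lie A X, B Y] + [Lie B X, A Y]
  - A ([Lie X, B Y] + [Lie B X, Y]) - B ([Lie X, A Y] + [Lie A X, Y]).

Definition haantjes_bracket A B X Y : vfield M :=
  let N := frolicher_nijenhuis_bracket A B in
  (A (B (N X Y)) + B (A (N X Y))) + N (A X) (B Y) + N (B X) (A Y)
  - A (N X (B Y) + N (B X) Y) - B (N X (A Y) + N (A X) Y).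
End Operators.

(* Main.v *)
From HB Require Import structures.
Require Import Defs.
From mathcomp Require Import all_boot all_order all_algebra.
From mathcomp Require Import all_classical all_reals all_analysis.
From mathcomp Require Import ring.
Set Implicit Arguments.
Unset Strict Implicit.
Unset Printing Implicit Defensive.
Import Order.TTheory GRing.Theory Num.Theory.
Import numFieldNormedType.Exports.
Local Open Scope classical_set_scope.
Local Open Scope ring_scope.

(** For commuting operators A and B that are semisimple and Haantjes, the torsions
    of the module are multiples of the Haantjes bracket:
      H_{fA+gB} = f^2 g^2 H_{A,B}                    [haantjes_torsion_comb]
    which gives the theorem, with f = g = 1 for the direct implication.

    Write E_C and F_C for the commutators of an operator C with the first and
    the second argument of a bracket: (E_C T)(X,Y) = C T(X,Y) - T(CX,Y) and
    (F_C T)(X,Y) = C T(X,Y) - T(X,CY).  They commute with each other when the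
    operators do, the Haantjes torsion is H_C = F_C^2 E_C^2 [,], and
    H_{A,B} = (E_A F_B + E_B F_A)^2 [,].  Each E removes the derivation term of
    the Lie bracket in X, and each F the one in Y.  Hence the mixed torsions
      T(C1,C2;D1,D2) = F_{D1} F_{D2} E_{C1} E_{C2} [,]       [mixed_haantjes]
    are tensors in X and Y.  They are also multilinear over the smooth functions
    in the four commuting operators: of the two commutators in one argument the
    outer one acts on a bracket that is already linear over the functions in
    this argument, so that it lets functions out, and the two can be exchanged.
    So H_{fA+gB} expands as a quartic polynomial in f and g, without derivatives
    of f and g, and
      H_{A,B} = T(A,A;B,B) + 2 T(A,B;A,B) + T(B,B;A,A).

    It remains to see that T(A,C;A,D) = 0 for C, D in {A, B}, and the same with
    B in place of A: this kills every term except f^2 g^2 (T(A,A;B,B) +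
    T(B,B;A,A)) in the torsion and the middle term of the bracket.  This is
    where semisimplicity enters.  The tensor S = T(A,C;A,D) has the form E_A S'
    and the form F_A S'', and E_A F_A S = E_C F_D H_A = 0.  At a point p
    decompose the tangent space into eigenspaces of A: if X(p), Y(p) have
    eigenvalues a, b, then the component of S(X,Y)(p) of eigenvalue c is
    multiplied by (c-a)(c-b) under E_A F_A, so it is 0 unless c = a or c = b;
    and as S(X,Y)(p) lies in the images of A-a and of A-b at p, it is 0 in these
    cases also [semisimple_reduced].  Only A is diagonalized, and only at p: a
    smooth common eigenframe of A and B need not exist where eigenvalues cross.

    The pointwise argument needs that the value at p of a tensor on global vector
    fields depends only on the values of its arguments at p.  For that, a local
    frame of eigenvectors is cut off by a smooth bump function into global
    fields W_i, and Cramer's rule writes a multiple mZ of any global field,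
    m(p) <> 0, as a combination of the W_i with smooth coefficients
    [semisimple_eigenframe].  The bump function is built from exp(-1/x) in a
    chart [bump_exists]. *)

(** * Smooth bump functions *)

Section FlatFunctions.
Context {R : realType}.
Implicit Types (m : nat) (x : R).

(** For m = 0 this is the usual flat function.  The powers of 1/x are there to
    make the family stable under differentiation, up to linear combination. *)
Definition flat m x : R := if 0 < x then x^-1 ^+ m * expR (- x^-1) else 0.

Lemma flat_pos m x : 0 < x -> flat m x = x^-1 ^+ m * expR (- x^-1).
Proof. by rewrite /flat => ->. Qed.

Lemma flat_npos m x : x <= 0 -> flat m x = 0.
Proof. by rewrite /flat ltNge => ->. Qed.

Lemma flat_gt0 m x : 0 < x -> 0 < flat m x.
Proof. by move=> x0; rewrite flat_pos// mulr_gt0 ?expR_gt0// exprn_gt0 ?invr_gt0. Qed.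

(** Quadratic decay at 0, uniform on both sides, is all that differentiability
    at 0 needs; it comes from exp y >= y^(m+2) / (m+2)! at y = 1/x. *)
Lemma flat_sqr m x : `|flat m x| <= m.+2`!%:R * x ^+ 2.
Proof.
have [x0|x0] := ltP 0 x; last by rewrite flat_npos// normr0 mulr_ge0 ?sqr_ge0.
rewrite gtr0_norm ?flat_gt0// flat_pos// expRN ler_pdivrMr ?expR_gt0//.
have y0 : 0 <= x^-1 by rewrite invr_ge0 ltW.
have := expR_ge1Dxn m.+1 y0.
set E := expR _ => H.
have {}H : x^-1 ^+ m.+2 <= m.+2`!%:R * E.
  rewrite mulrC -ler_pdivrMr ?ltr0n ?fact_gt0//; apply: le_trans H.
  by rewrite lerDr.
have -> : x^-1 ^+ m = x ^+ 2 * x^-1 ^+ m.+2.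
  by rewrite -[m.+2]addn2 exprD mulrCA -exprMn mulfV ?lt0r_neq0// expr1n mulr1.
rewrite [leRHS](_ : _ = x ^+ 2 * (m.+2`!%:R * E)); last by ring.
by rewrite ler_wpM2l// sqr_ge0.
Qed.

Lemma is_derive_flat m x :
  is_derive x 1 (flat m) (flat m.+2 x - m%:R * flat m.+1 x).
Proof.
have [x0|x0|<-] := ltgtP 0 x.
- pose F (y : R) := y^-1 ^+ m * expR (- y^-1).
  have nF : \forall y \near x, F y = flat m y.
    near=> y; rewrite flat_pos//; near: y; exact: lt_nbhsr.
  apply: (near_eq_is_derive nF).
  have xn0 : x != 0 by rewrite gt_eqF.
  have dV : is_derive x 1 (fun y : R => y^-1) (- x ^- 2).
    have := @is_deriveV R id x 1 1 xn0 (is_derive_id _ _).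
    by move/is_derive_eq; apply; rewrite /= [_ *: 1]mulr1.
  have dE : is_derive x 1 (fun y : R => expR (- y^-1)) (expR (- x^-1) * x ^- 2).
    apply: (@is_derive1_comp R expR (fun y => - y^-1)).
    by have /is_derive_eq := is_deriveN dV; apply; rewrite opprK.
  have := is_deriveM (is_deriveX m dV) dE.
  rewrite !exprfctE => /is_derive_eq; apply.
  rewrite !flat_pos// /GRing.scale /=.
  case: m {F nF} => [|m]; rewrite ?mul0r ?subr0 !exprS !expr0 /=.
    by field.
  by move: (x^-1 ^+ m) => P; field.
- have nF : \forall y \near x, cst 0 y = flat m y.
    near=> y; rewrite flat_npos//; apply: ltW; near: y; exact: lt_nbhsl.
  apply: (near_eq_is_derive nF).
  rewrite !flat_npos ?(ltW x0)// mulr0 subr0; exact: is_derive_cst.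
(* At 0 the difference quotient is O(h), by the quadratic decay. *)
rewrite !flat_npos// mulr0 subr0.
have C : (fun h : R => h^-1 *: ((flat m \o shift 0) (h *: 1) - flat m 0)) @ 0^' --> (0 : R).
  apply/cvgrPdist_le => e e0; near=> h.
  have h0 : h != 0 by near: h; exact: nbhs_dnbhs_neq.
  rewrite sub0r normrN /= addr0 (flat_npos m (lexx 0)) subr0.
  rewrite [h *: 1]mulr1 [_ *: _]/(_ * _) normrM normfV.
  rewrite mulrC ler_pdivrMr ?normr_gt0//; apply: (le_trans (flat_sqr m h)).
  rewrite -real_normK ?num_real// expr2 mulrA ler_wpM2r//.
  rewrite mulrC -ler_pdivlMr ?ltr0n ?fact_gt0//.
  by near: h; apply: dnbhs0_le; rewrite divr_gt0// ltr0n fact_gt0.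
by apply: DeriveDef; [apply/cvg_ex; exists 0|exact/cvg_lim].
Unshelve. all: by end_near. Qed.

Lemma flat_differentiable m x : differentiable (flat m) x.
Proof. by apply/derivable1_diffP; case: (is_derive_flat m x). Qed.

(** The induction on k is over all m at once: by the chain rule one derivative
    in a direction replaces m by m+1 and m+2. *)
Lemma Ck_on_flat (V : normedModType R) k m (U : set V) (u : V -> R) :
  open U -> Ck_on k U u -> Ck_on k U (flat m \o u).
Proof.
move=> oU; elim: k m u => [|k IH] m u.
  move=> uC x Ux; apply: continuous_comp (uC x Ux) _.
  exact/differentiable_continuous/flat_differentiable.
move=> uS; have [uD uC] := uS; split=> [x Ux|v].
  exact: differentiable_comp (uD x Ux) (flat_differentiable _ _).
have uS' := Ck_on_le uS.
have dS := Ck_onD oU (IH m.+2 _ uS')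
  (Ck_onM oU (Ck_on_cst k U (- m%:R : R)) (IH m.+1 _ uS')).
apply: Ck_on_eq oU _ (Ck_onM oU dS (uC v)) => x Ux /=.
have fD := flat_differentiable m (u x).
rewrite [RHS]deriveE; last exact: differentiable_comp (uD x Ux) fD.
rewrite diff_comp ?[in LHS]/=; [|exact: uD|exact: fD].
rewrite [RHS]/= -(deriveE v (uD x Ux)) deriv1E; last by case: (is_derive_flat m (u x)).
rewrite derive1E (@derive_val _ _ _ _ _ _ _ (is_derive_flat m (u x))).
by rewrite mulNr [RHS]mulrC.
Qed.

End FlatFunctions.

Section SmoothClosure.
Context {R : realType}.
Implicit Types V W : normedModType R.

Lemma Ck_on_subset V W k (U U' : set V) (f : V -> W) :
  U' `<=` U -> Ck_on k U f -> Ck_on k U' f.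
Proof.
move=> UU'; elim: k f => [|k IH] f /=; first by move=> fC x /UU'; exact: fC.
by move=> [fD fC]; split=> [x /UU'|v]; [exact: fD|exact: IH].
Qed.

Lemma Ck_onU V W k (U1 U2 : set V) (f : V -> W) :
  Ck_on k U1 f -> Ck_on k U2 f -> Ck_on k (U1 `|` U2) f.
Proof.
elim: k f => [|k IH] f /=; first by move=> f1 f2 x [/f1|/f2].
by move=> [fD1 fC1] [fD2 fC2]; split=> [x [/fD1|/fD2]//|v]; exact: IH.
Qed.

Lemma Ck_on_coord V n k (U : set V) (F : V -> 'rV[R]_n) i : open U ->
  Ck_on k U F -> Ck_on k U (fun x => F x 0 i).
Proof.
move=> oU; elim: k F => [|k IH] F.
  move=> FC x Ux; exact: (@continuous_comp _ _ _ F (fun N : 'rV_n => N 0 i) x (FC x Ux)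
    (@coord_continuous _ _ _ 0 i (F x))).
move=> [FD FC]; split=> [x Ux|v].
  exact: (@differentiable_comp _ V _ R F (fun N => N 0 i) x (FD x Ux) (differentiable_coord _ _ _)).
apply: Ck_on_eq oU _ (IH _ (FC v)) => x Ux /=.
by rewrite derive_mx ?mxE//; apply: diff_derivable; exact: FD.
Qed.

Lemma Ck_on_prod V n k (U : set V) (F : 'I_n -> V -> R) : open U ->
  (forall i, Ck_on k U (F i)) -> Ck_on k U (fun x => \prod_i F i x).
Proof.
move=> oU FC; elim: (index_enum _) => [|i s IH].
  by under eq_fun do rewrite big_nil; exact: Ck_on_cst.
by under eq_fun do rewrite big_cons; exact: Ck_onM.
Qed.
End SmoothClosure.

Section Bump.
Context {R : realType} {n : nat}.

Lemma chart_image_open (T : topologicalType) (c : chart R n T) (O : set T) :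
  open O -> open (c @` (chart_dom c `&` O)).
Proof.
move=> oO.
have -> : c @` (chart_dom c `&` O) = (c @` chart_dom c) `&` (chart_inv c @^-1` O).
  apply/seteqP; split=> [_ [q [cq Oq] <-]|_ [[q cq <-]]] /=.
    by split; [exists q|rewrite /= chart_mapK].
  by rewrite /= chart_mapK// => Oq; exists q.
have := @chart_inv_continuous _ _ _ c.
rewrite continuous_open_subspace; last exact: chart_img_open.
by move=> /continuous_inP; apply => //; exact: chart_img_open.
Qed.

(** Each factor is positive exactly when the coordinate is within e of that of y0,
    so the product is positive on an open ball of the maximum norm, which is the
    norm of row vectors. *)
Definition cube_bump (y0 : 'rV[R]_n) (e : R) (y : 'rV[R]_n) : R :=
  \prod_i flat 0 (e ^+ 2 - (y 0 i - y0 0 i) ^+ 2).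

Lemma cube_bump_center y0 e : 0 < e -> cube_bump y0 e y0 != 0.
Proof.
move=> e0; rewrite gt_eqF// prodr_gt0// => i _.
by rewrite subrr expr0n subr0 flat_gt0// exprn_gt0.
Qed.

Lemma cube_bump_support y0 e y : 0 < e -> cube_bump y0 e y != 0 -> `|y0 - y| <= e.
Proof.
move=> e0 /prodf_neq0 H; rewrite [leLHS]/Num.Def.normr /= mx_normrE.
apply: bigmax_le => [|[i j] _ /=]; first exact: ltW.
rewrite !mxE (ord1 i) distrC.
have := H j isT; apply: contraR; rewrite -ltNge => eyj.
rewrite flat_npos// subr_le0 -[leRHS]real_normK ?num_real//.
by rewrite lerXn2r ?nnegrE ?(ltW e0) ?(ltW eyj).
Qed.

Lemma Ck_on_cube_bump (V : normedModType R) k (U : set V) (F : V -> 'rV[R]_n) y0 e :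
  open U -> Ck_on k U F -> Ck_on k U (cube_bump y0 e \o F).
Proof.
move=> oU FC; apply: (Ck_on_prod oU) => i; apply: Ck_on_flat => //.
have dC : Ck_on k U (fun x => F x 0 i - y0 0 i).
  exact: (Ck_onD oU (Ck_on_coord i oU FC) (Ck_on_cst k U (- y0 0 i : R))).
have := Ck_onD oU (Ck_on_cst k U (e ^+ 2 : R))
  (Ck_onM oU (Ck_on_cst k U (-1 : R)) (Ck_onM oU dC dC)).
by apply: Ck_on_eq => // x _ /=; rewrite mulN1r expr2.
Qed.

(** Multiplication by psi turns what is smooth on U only, such as the
    fields of a local frame, into a global object.  The function psi is 0 off the
    image K of a compact ball of a chart c.  As M is Hausdorff, K is closed, so
    smoothness of psi s can be checked on two open sets that cover M: the
    complement of K, where psi s = 0, and the part of U in the domain of c. *)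
Lemma bump_exists (M : manifold R n) (p : M) (U : set M) :
  open U -> U p -> exists psi : M -> R,
    [/\ psi p != 0, forall q, ~ U q -> psi q = 0 &
        forall s : M -> R, smooth_on U s -> smooth_on setT (fun q => psi q * s q)].
Proof.
move=> oU Up; have [c ac cp] := atlas_cover p.
have : nbhs (c p) (c @` (chart_dom c `&` U)).
  by apply: open_nbhs_nbhs; split; [exact: chart_image_open|exists p].
move=> /nbhs_ballP[r /= r0 ballU].
(* The closed ball of radius r / 2 still lies in the open ball of radius r. *)
pose e := r / 2; have e0 : 0 < e by rewrite divr_gt0.
pose Q : set 'rV[R]_n := [set y | `|c p - y| <= e].
have QU : Q `<=` c @` (chart_dom c `&` U).
  move=> y Qy; apply: ballU; rewrite -ball_normE /ball_ /=.
  by apply: (le_lt_trans Qy); rewrite ltr_pdivrMr// ltr_pMr// ltr1n.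
have Q_compact : compact Q.
  have QE : Q = closed_ball (c p) e by rewrite closed_ballE.
  apply: bounded_closed_compact; last by rewrite QE; exact: closed_ball_closed.
  exists (`|c p| + e); split; first exact: num_real.
  move=> x ex y Qy; apply: le_trans (ltW ex).
  by rewrite -lerBlDl; apply: le_trans Qy; rewrite distrC; exact: lerB_dist.
pose K := chart_inv c @` Q.
have KU : K `<=` chart_dom c `&` U.
  by move=> _ [y /QU[q [cq Uq] <-] <-]; rewrite chart_mapK.
have K_closed : closed K.
  apply: (compact_closed (@manifold_hausdorff _ _ M)); apply: continuous_compact => //.
  apply: continuous_subspaceW (@chart_inv_continuous _ _ _ c).
  by move=> y /QU[q [cq _] <-]; exists q.
pose psi q := if `[< K q >] then cube_bump (c p) e (c q) else 0.
have psiE q : chart_dom c q -> psi q = cube_bump (c p) e (c q).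
  move=> cq; rewrite /psi; case: asboolP => // Kq; apply/esym/eqP.
  apply: contra_notT Kq => /(cube_bump_support e0) Qq.
  by exists (c q) => //; rewrite chart_mapK.
have psi0 q : ~ K q -> psi q = 0 by rewrite /psi; case: asboolP.
exists psi; split.
- by rewrite psiE// cube_bump_center.
- by move=> q Uq; apply: psi0 => /KU[].
move=> s sS d ad k.
pose U1 := d @` (chart_dom d `&` (chart_dom c `&` U)).
pose U2 := d @` (chart_dom d `&` ~` K).
have oU1 : open U1 by apply/chart_image_open/openI => //; exact: chart_dom_open.
have oU2 : open U2 by apply/chart_image_open/closed_openC.
apply: (@Ck_on_subset _ _ _ _ (U1 `|` U2)).
  move=> _ [q [dq _] <-]; have [Kq|Kq] := pselect (K q).
    by left; exists q => //; split=> //; exact: KU.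
  by right; exists q.
apply: Ck_onU.
  have FS : Ck_on k U1 (c \o chart_inv d).
    apply: Ck_on_subset (atlas_compat ad ac k).
    by move=> _ [q [dq [cq _]] <-]; exists q.
  have sS1 : Ck_on k U1 (s \o chart_inv d).
    by apply: Ck_on_subset (sS d ad k) => _ [q [dq [_ Uq]] <-]; exists q.
  apply: Ck_on_eq oU1 _ (Ck_onM oU1 (Ck_on_cube_bump (c p) e oU1 FS) sS1).
  by move=> _ [q [dq [cq _]] <-] /=; rewrite chart_mapK// psiE.
apply: Ck_on_eq oU2 _ (Ck_on_cst k U2 (0 : R)) => _ [q [dq Kq] <-] /=.
by rewrite chart_mapK// psi0// mul0r.
Qed.

End Bump.

(** * Vector fields as a module over the smooth functions *)

Local Notation "[ 'Lie' X , Y ]" := (lie_bracket X Y) (at level 0) : ring_scope.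

Section VectorFieldModule.
Context {R : realType} {n : nat} (M : manifold R n).
Implicit Types (X Y Z : vfield M) (f g h : Cinf M) (A B C D : operator M).

Fact vscale_smooth h X : smooth_section setT (fun p => h p *: X p).
Proof. by move=> f; apply: smoothM; [exact/asboolP/(Cinf_subproof h)|exact: vfield_smooth]. Qed.
Definition vscale h X : vfield M := MkVfield (vscale_smooth h X).

Fact vscaleA h g X : vscale h (vscale g X) = vscale (h * g) X.
Proof. by apply: vfieldP => p f; rewrite /= scalerA. Qed.
Fact vscale1 : left_id 1 vscale.
Proof. by move=> X; apply: vfieldP => p f; rewrite /= scale1r. Qed.
Fact vscaleDr : right_distributive vscale +%R.
Proof. by move=> h X Y; apply: vfieldP => p f; rewrite /= scalerDr. Qed.
Fact vscaleDl X : {morph vscale^~ X : f g / f + g}.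
Proof. by move=> h g; apply: vfieldP => p f; rewrite /= scalerDl. Qed.
HB.instance Definition _ := GRing.Zmodule_isLmodule.Build (Cinf M) (vfield M)
  vscaleA vscale1 vscaleDr vscaleDl.

Lemma vfieldDE X Y p f : (X + Y) p f = X p f + Y p f. Proof. by []. Qed.
Lemma vfieldNE X p f : (- X) p f = - X p f. Proof. by []. Qed.
Lemma vfield0E p f : (0 : vfield M) p f = 0. Proof. by []. Qed.
Lemma vfieldZE h X p f : (h *: X) p f = h p * X p f. Proof. by []. Qed.
Lemma lieE X Y p f : [Lie X, Y] p f = X p (vfield_app Y f) - Y p (vfield_app X f).
Proof. by []. Qed.
Definition vfieldE := (vfieldDE, vfieldNE, vfield0E, vfieldZE).

Lemma vfield_atD X Y p : (X + Y) p = X p + Y p. Proof. by []. Qed.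
Lemma vfield_atB X Y p : (X - Y) p = X p - Y p. Proof. by []. Qed.
Lemma vfield_atN X p : (- X) p = - X p. Proof. by []. Qed.
Lemma vfield_atZ h X p : (h *: X) p = h p *: X p. Proof. by []. Qed.
Lemma op_atE A X p : A X p = op_at A p (X p). Proof. by []. Qed.

Lemma vfield_at_inj X Y : (forall p, X p = Y p) -> X = Y.
Proof. by move=> XY; apply: vfieldP => p f; rewrite XY. Qed.

Lemma CinfNE f p : (- f) p = - f p. Proof. by []. Qed.
Lemma CinfME f g p : (f * g) p = f p * g p. Proof. by []. Qed.

Lemma tangentD p (v : tangent p) f g : v (f + g) = v f + v g.
Proof. by have := (tangentP v).1 1 f g; rewrite scale1r mul1r. Qed.
Lemma tangentM p (v : tangent p) f g : v (f * g) = v f * g p + f p * v g.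
Proof. exact: (tangentP v).2. Qed.
Lemma tangentN p (v : tangent p) f : v (- f) = - v f.
Proof.
apply/eqP; rewrite -addr_eq0 -tangentD addNr; apply/eqP.
by apply: (@addrI _ (v 0)); rewrite -tangentD !addr0.
Qed.

Lemma vfield_appD X Y f : vfield_app (X + Y) f = vfield_app X f + vfield_app Y f.
Proof. exact/val_inj. Qed.
Lemma vfield_appN X f : vfield_app (- X) f = - vfield_app X f.
Proof. exact/val_inj. Qed.
Lemma vfield_appZ h X f : vfield_app (h *: X) f = h * vfield_app X f.
Proof. exact/val_inj. Qed.

Lemma op_linear A : linear (A : vfield M -> vfield M).
Proof. by move=> h X Y; apply: vfield_at_inj => p; rewrite /= linearP. Qed.
HB.instance Definition _ A := GRing.isLinear.Build (Cinf M) (vfield M) (vfield M) _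
  (op_app A) (@op_linear A).

Lemma opD A X Y : A (X + Y) = A X + A Y. Proof. exact: linearD. Qed.
Lemma opN A X : A (- X) = - A X. Proof. exact: linearN. Qed.
Lemma opZ A h X : A (h *: X) = h *: A X. Proof. exact: linearZ. Qed.

Lemma op_combE f A g B X : op_comb f A g B X = f *: A X + g *: B X.
Proof. exact: vfield_at_inj. Qed.

Lemma lieDl X Y Z : [Lie X + Y, Z] = [Lie X, Z] + [Lie Y, Z].
Proof.
by apply: vfieldP => p f; rewrite !(vfieldE, lieE) !vfield_appD !tangentD; ring.
Qed.
Lemma lieC X Y : [Lie X, Y] = - [Lie Y, X].
Proof. by apply: vfieldP => p f; rewrite !(vfieldE, lieE) opprB. Qed.
Lemma lieNl X Z : [Lie - X, Z] = - [Lie X, Z].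
Proof.
by apply: vfieldP => p f; rewrite !(vfieldE, lieE) !vfield_appN !tangentN; ring.
Qed.
Lemma lieZl h X Y : [Lie h *: X, Y] = h *: [Lie X, Y] - vfield_app Y h *: X.
Proof.
apply: vfieldP => p f; rewrite !(vfieldE, lieE) !vfield_appZ !tangentM /=.
by ring.
Qed.

End VectorFieldModule.

(** * Mixed Haantjes torsions of commuting operators *)

Section MixedTorsion.
Context {R : realType} {n : nat} (M : manifold R n).
Implicit Types (X Y Z : vfield M) (f g h : Cinf M) (A B C D : operator M).
Implicit Types T S : vfield M -> vfield M -> vfield M.

Definition op_commute A B := forall X, A (B X) = B (A X).

Lemma op_commute_sym A B : op_commute A B -> op_commute B A.
Proof. by move=> AB X; rewrite AB. Qed.

Lemma op_commute_comb A B f g C :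
  op_commute A C -> op_commute B C -> op_commute (op_comb f A g B) C.
Proof. by move=> AC_ BC_ X; rewrite !op_combE AC_ BC_ opD !opZ. Qed.

(** Commutators of an operator with the first and the second argument of T. *)
Definition adl A T X Y := A (T X Y) - T (A X) Y.
Definition adr A T X Y := A (T X Y) - T X (A Y).

(** The polarization of the Haantjes torsion, with the operators of the two
    arguments kept apart. *)
Definition mixed_haantjes C1 C2 D1 D2 :=
  adr D1 (adr D2 (adl C1 (adl C2 (@lie_bracket R n M)))).

Definition linear_l T := forall h X Z Y, T (h *: X + Z) Y = h *: T X Y + T Z Y.

(** The defect of linearity of [X, Y] in X is X |-> - Y(h) X, a multiplication by
    a function: it commutes with C, so it disappears in the commutator. *)
Lemma adl_lie_linear C : linear_l (adl C (@lie_bracket R n M)).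
Proof.
move=> h X Z Y; rewrite /adl !(lieDl, lieZl, opD, opN, opZ).
by apply: vfieldP => p f; rewrite !vfieldE; ring.
Qed.

Lemma linear_l_adl C S : linear_l S -> linear_l (adl C S).
Proof.
move=> Slin h X Z Y; rewrite /adl !(Slin, opD, opZ).
by apply: vfieldP => p f; rewrite !vfieldE; ring.
Qed.

Lemma linear_l_adr D S : linear_l S -> linear_l (adr D S).
Proof.
move=> Slin h X Z Y; rewrite /adr !(Slin, opD, opZ).
by apply: vfieldP => p f; rewrite !vfieldE; ring.
Qed.

Lemma mixed_haantjes_linear_l C1 C2 D1 D2 : linear_l (mixed_haantjes C1 C2 D1 D2).
Proof. by do 2![apply: linear_l_adr]; apply/linear_l_adl/adl_lie_linear. Qed.

Lemma linear_lD S X1 X2 Y : linear_l S -> S (X1 + X2) Y = S X1 Y + S X2 Y.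
Proof. by move=> Slin; have := Slin 1 X1 X2 Y; rewrite !scale1r. Qed.

Lemma linear_l0 S Y : linear_l S -> S 0 Y = 0.
Proof.
move=> Slin; apply: (@addrI _ (S 0 Y)).
by rewrite -(linear_lD _ _ _ Slin) !addr0.
Qed.

Lemma linear_lZ S h X Y : linear_l S -> S (h *: X) Y = h *: S X Y.
Proof. by move=> Slin; have := Slin h X 0 Y; rewrite (linear_l0 _ Slin) !addr0. Qed.

(** Linearity of S is what lets the coefficients f and g out without being
    differentiated. *)
Lemma adl_comb S f A g B X Y : linear_l S ->
  adl (op_comb f A g B) S X Y = f *: adl A S X Y + g *: adl B S X Y.
Proof.
move=> Slin; rewrite /adl !op_combE (linear_lD _ _ _ Slin) !(linear_lZ _ _ _ Slin).
by apply: vfieldP => p k; rewrite !vfieldE; ring.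
Qed.

Lemma adl_swap A B T : op_commute A B -> adl A (adl B T) = adl B (adl A T).
Proof.
move=> AB; apply/funext => X; apply/funext => Y.
rewrite /adl !(opD, opN) !AB.
by apply: vfieldP => p k; rewrite !vfieldE; ring.
Qed.

Lemma mixed_haantjes_comb1 C2 D1 D2 f A g B X Y :
  mixed_haantjes (op_comb f A g B) C2 D1 D2 X Y =
  f *: mixed_haantjes A C2 D1 D2 X Y + g *: mixed_haantjes B C2 D1 D2 X Y.
Proof.
rewrite /mixed_haantjes /adr !adl_comb; try exact: adl_lie_linear.
rewrite !(opD, opN, opZ).
by apply: vfieldP => p k; rewrite !vfieldE; ring.
Qed.

Lemma mixed_haantjes_swapl C1 C2 D1 D2 : op_commute C1 C2 ->
  mixed_haantjes C1 C2 D1 D2 = mixed_haantjes C2 C1 D1 D2.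
Proof.
by move=> C12; rewrite /mixed_haantjes (adl_swap _ C12).
Qed.

(** Antisymmetry of the Lie bracket carries every property of the first argument
    over to the second. *)
Lemma mixed_haantjes_flip C1 C2 D1 D2 X Y :
  op_commute C1 D1 -> op_commute C1 D2 -> op_commute C2 D1 -> op_commute C2 D2 ->
  mixed_haantjes C1 C2 D1 D2 X Y = - mixed_haantjes D1 D2 C1 C2 Y X.
Proof.
move=> C1D1 C1D2 C2D1 C2D2; rewrite /mixed_haantjes /adr /adl.
rewrite !(opD, opN) !(C1D1, C1D2, C2D1, C2D2).
rewrite ![[Lie Y, _]]lieC ![[Lie D2 Y, _]]lieC ![[Lie D1 Y, _]]lieC.
rewrite ![[Lie D2 (D1 Y), _]]lieC !(opN).
by apply: vfieldP => p k; rewrite !vfieldE; ring.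
Qed.

Lemma adl_adr A D T : op_commute A D -> adl A (adr D T) = adr D (adl A T).
Proof.
move=> AD; apply/funext => X; apply/funext => Y.
rewrite /adl /adr !(opD, opN) !AD.
by apply: vfieldP => p k; rewrite !vfieldE; ring.
Qed.

Lemma adr_swap A B T : op_commute A B -> adr A (adr B T) = adr B (adr A T).
Proof.
move=> AB; apply/funext => X; apply/funext => Y.
rewrite /adr !(opD, opN) !AB.
by apply: vfieldP => p k; rewrite !vfieldE; ring.
Qed.

Lemma mixed_haantjes_swapr C1 C2 D1 D2 : op_commute D1 D2 ->
  mixed_haantjes C1 C2 D1 D2 = mixed_haantjes C1 C2 D2 D1.
Proof. by move=> D12; rewrite /mixed_haantjes (adr_swap _ D12). Qed.

Lemma mixed_haantjes_adl A C D1 D2 : op_commute A D1 -> op_commute A D2 ->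
  mixed_haantjes A C D1 D2 = adl A (adr D1 (adr D2 (adl C (@lie_bracket R n M)))).
Proof. by move=> AD1 AD2; rewrite (adl_adr _ AD1) (adl_adr _ AD2). Qed.

(** Expand the first operator, exchange it with the second, and expand again. *)
Lemma mixed_haantjes_double_l A B f g D1 D2 X Y : op_commute A B ->
  let C := op_comb f A g B in
  mixed_haantjes C C D1 D2 X Y =
    f *: (f *: mixed_haantjes A A D1 D2 X Y) + g *: (g *: mixed_haantjes B B D1 D2 X Y)
    + (f *: (g *: mixed_haantjes A B D1 D2 X Y) + f *: (g *: mixed_haantjes A B D1 D2 X Y)).
Proof.
move=> AB C; have AA : op_commute A A by [].
have AC_ : op_commute A C.
  by apply: op_commute_sym; apply: op_commute_comb => //; exact: op_commute_sym.
have BC_ : op_commute B C.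
  by apply: op_commute_sym; apply: op_commute_comb.
rewrite mixed_haantjes_comb1 (mixed_haantjes_swapl _ _ AC_) (mixed_haantjes_swapl _ _ BC_).
rewrite !mixed_haantjes_comb1 (mixed_haantjes_swapl _ _ (op_commute_sym AB)).
move: (mixed_haantjes A A D1 D2 X Y) (mixed_haantjes B B D1 D2 X Y).
move: (mixed_haantjes A B D1 D2 X Y) => TAB TAA TBB.
by apply: vfieldP => p k; rewrite !vfieldE; ring.
Qed.

Lemma mixed_haantjes_double_r A B f g C1 C2 X Y : op_commute A B ->
  op_commute C1 A -> op_commute C1 B -> op_commute C2 A -> op_commute C2 B ->
  let D := op_comb f A g B in
  mixed_haantjes C1 C2 D D X Y =
    f *: (f *: mixed_haantjes C1 C2 A A X Y) + g *: (g *: mixed_haantjes C1 C2 B B X Y)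
    + (f *: (g *: mixed_haantjes C1 C2 A B X Y) + f *: (g *: mixed_haantjes C1 C2 A B X Y)).
Proof.
move=> AB C1A C1B C2A C2B D.
have comm C : op_commute C A -> op_commute C B -> op_commute C D.
  by move=> CA CB; apply/op_commute_sym/op_commute_comb; exact: op_commute_sym.
rewrite [LHS]mixed_haantjes_flip ?mixed_haantjes_double_l; try exact: comm; last by [].
rewrite ![mixed_haantjes C1 C2 _ _ X Y]mixed_haantjes_flip//.
move: (mixed_haantjes A A C1 C2 Y X) (mixed_haantjes B B C1 C2 Y X).
move: (mixed_haantjes A B C1 C2 Y X) => TAB TAA TBB.
by apply: vfieldP => p k; rewrite !vfieldE; ring.
Qed.

Lemma haantjes_torsionE A X Y :
  haantjes_torsion A X Y = mixed_haantjes A A A A X Y.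
Proof.
rewrite /haantjes_torsion /nijenhuis_torsion /mixed_haantjes /adr /adl !(opD, opN).
by apply: vfieldP => p k; rewrite !vfieldE; ring.
Qed.

Lemma haantjes_bracketE A B X Y : op_commute A B ->
  haantjes_bracket A B X Y = mixed_haantjes A A B B X Y + mixed_haantjes B B A A X Y
    + (mixed_haantjes A B A B X Y + mixed_haantjes A B A B X Y).
Proof.
move=> AB.
rewrite /haantjes_bracket /frolicher_nijenhuis_bracket /mixed_haantjes /adr /adl.
rewrite !(opD, opN) !AB.
by apply: vfieldP => p k; rewrite !vfieldE; ring.
Qed.

End MixedTorsion.

(** The two ways of writing (L - a)(L - b) v in which the pointwise argument
    meets it. *)
Lemma linear_subZ_comm (K : comPzRingType) (V : lmodType K) (L : {linear V -> V}) a b v :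
  L (L v - b *: v) - a *: (L v - b *: v) = L (L v - b *: v) - (L (a *: v) - b *: (a *: v)).
Proof. by rewrite [L (a *: v)]linearZ /= scalerBr [b *: (a *: v)]scalerA mulrC -scalerA. Qed.


(** * Semisimple operators at a point *)

Section Eigenframes.
Context {R : realType} {n : nat} (M : manifold R n).
Implicit Types (X Y Z : vfield M) (f g h : Cinf M) (A B C D : operator M).
Implicit Types T S : vfield M -> vfield M -> vfield M.

Lemma tangentZE p a (v : tangent p) f : (a *: v) f = a * v f. Proof. by []. Qed.
Lemma tangent_sumE p k (v : 'I_k -> tangent p) f :
  (\sum_i v i) f = \sum_i v i f.
Proof. by elim/big_ind2: _ => // _ a _ b <- <-. Qed.
Lemma tangent_eq p (v w : tangent p) : (forall f, v f = w f) -> v = w.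
Proof. by move=> vw; apply/val_inj/funext. Qed.

(** The rows of a matrix A of maximal rank with all u *m A of the form
    (e_i f)_i span all of R^k: otherwise some c <> 0 is orthogonal to them,
    freeness gives an f on which the combination c of the e_i does not vanish,
    and adding the row of f increases the rank. *)
Lemma dual_functions k p (e : 'I_k -> tangent p) :
  (forall c : 'rV[R]_k, \sum_i c 0 i *: e i = 0 -> c = 0) ->
  exists f : 'I_k -> Cinf M, forall i j, e i (f j) = (i == j)%:R.
Proof.
move=> free_e.
pose ev f : 'rV[R]_k := \row_i e i f.
pose attained (A : 'M[R]_k) := forall u : 'rV_k, exists f, u *m A = ev f.
have evD f g : ev (f + g) = ev f + ev g.
  by apply/rowP => i; rewrite !mxE tangentD.
have evZ a f : ev (a *: f) = a *: ev f.
  apply/rowP => i; rewrite !mxE; have := (tangentP (e i)).1 a f 0.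
  rewrite addr0 => ->; rewrite (_ : e i 0 = 0) ?addr0//.
  by apply: (@addrI _ (e i 0)); rewrite -tangentD !addr0.
pose P r := `[< exists2 A, attained A & \rank A = r >].
have P0 : exists r, P r.
  exists 0%N; apply/asboolP; exists 0; last by rewrite mxrank0.
  move=> u; exists 0; rewrite mulmx0; apply/esym.
  by apply: (@addrI _ (ev 0)); rewrite -evD !addr0.
have Pk r : P r -> (r <= k)%N by move=> /asboolP[A _ <-]; exact: rank_leq_col.
case: (ex_maxnP P0 Pk) => r /asboolP[A attA rA] rmax.
have rk : r = k.
  apply/eqP; rewrite eqn_leq -{1}rA rank_leq_col /= leqNgt; apply/negP => rltk.
  have /eqP/rowV0Pn[c /sub_kermxP cA c0] : kermx A^T <> 0.
    by move/eqP; rewrite kermx_eq0 /row_free mxrank_tr rA => /eqP rk; rewrite rk ltnn in rltk.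
  have [f cf] : exists f, ev f *m c^T != 0.
    apply/not_existsP => H; move/eqP: c0; apply; apply: free_e.
    apply: tangent_eq => f; rewrite tangent_sumE.
    have := H f; move/negP; rewrite negbK => /eqP/matrixP/(_ 0 0).
    rewrite !mxE => E; rewrite -[RHS]E; apply: eq_bigr => i _.
    by rewrite tangentZE !mxE mulrC.
  have attAf : attained (A + ev f)%MS.
    move=> u; have /sub_addsmxP[[u1 u2] /= ->] := submxMl u (A + ev f)%MS.
    have [g ->] := attA u1; rewrite [u2]mx11_scalar mul_scalar_mx.
    by exists (g + u2 0 0 *: f); rewrite evD evZ.
  have /rmax : P (\rank (A + ev f)%MS) by apply/asboolP; exists (A + ev f)%MS.
  rewrite leqNgt => /negP; apply; rewrite -rA; apply: rank_ltmx.
  rewrite ltmxE addsmxSl/= ; apply/negP => /(submx_trans (addsmxSr _ _)).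
  case/submxP => w wE; move/negP: cf; apply; rewrite wE -mulmxA.
  by rewrite -[A *m _]trmxK trmx_mul trmxK cA trmx0 mulmx0.
have Au : A \in unitmx by rewrite -row_full_unit /row_full rA rk.
have /boolp.choice[f fE] : forall j, exists f, ev f = delta_mx 0 j.
  move=> j; have [f fE] := attA (delta_mx 0 j *m invmx A).
  by exists f; rewrite -fE -mulmxA mulVmx// mulmx1.
by exists f => i j; have /rowP/(_ i) := fE j; rewrite !mxE eqxx /=.
Qed.

Definition Cinf_eval (q : M) (f : Cinf M) : R := f q.
Fact Cinf_eval_zmod q : zmod_morphism (Cinf_eval q).
Proof. by []. Qed.
Fact Cinf_eval_monoid q : monoid_morphism (Cinf_eval q).
Proof. by []. Qed.
HB.instance Definition _ q :=
  GRing.isZmodMorphism.Build (Cinf M) R (Cinf_eval q) (Cinf_eval_zmod q).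
HB.instance Definition _ q :=
  GRing.isMonoidMorphism.Build (Cinf M) R (Cinf_eval q) (Cinf_eval_monoid q).

Lemma vfield_sum_at k (V : 'I_k -> vfield M) q : (\sum_i V i) q = \sum_i V i q.
Proof. by elim/big_ind2: _ => // _ a _ b <- <-. Qed.

(** Global fields which diagonalize A at the point p only.  The last clause, with
    m p != 0, is a division-free way to say that the W i generate all fields
    near p, with coefficients that vanish at p for fields that vanish at p. *)
Record eigenframe A p (W : 'I_n -> vfield M) (lam : 'I_n -> R) (m : Cinf M) : Prop :=
  Eigenframe {
  eigenframe_neq0 : m p != 0;
  eigenframe_eigen : forall i, A (W i) p = lam i *: W i p;
  eigenframe_free : forall c : 'rV[R]_n, \sum_i c 0 i *: W i p = 0 -> c = 0;
  eigenframe_span : forall v : tangent p,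
    exists c : 'rV[R]_n, v = \sum_i c 0 i *: W i p;
  eigenframe_expand : forall Z, exists h : 'I_n -> Cinf M,
    m *: Z = \sum_i h i *: W i /\ (Z p = 0 -> forall i, h i p = 0) }.

(** Cut off the eigenframe of A around p with a bump function psi, and choose
    functions f_j dual to the resulting W_i at p.  If Z = sum_i z_i W_i then
    (Z f_j)_j = z *m G with G = (W_i f_j)_{ij}, so that det(G) z is given by the
    smooth functions (Z f_j)_j *m adj(G); moreover det(G) = 1 at p. *)
Lemma semisimple_eigenframe A p : semisimple A ->
  exists W lam m, eigenframe A p W lam m.
Proof.
move=> /(_ p)[U [oU Up [e [lam [[e_smooth e_basis] e_eigen]]]]].
have [psi [psip psi0 psiS]] := bump_exists oU Up.
have psi_smooth : psi \in smooth_pred M.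
  apply/asboolP; rewrite (_ : psi = fun q => psi q * 1); first exact/psiS/smooth_on_cst.
  by apply/funext => q; rewrite mulr1.
pose psiC : Cinf M := MkCinf psi_smooth.
have W_smooth i : smooth_section setT (fun q => psi q *: e i q).
  by move=> f; apply: psiS; exact: e_smooth.
pose W i := MkVfield (W_smooth i).
have psiU q : psi q != 0 -> U q.
  by move=> psiq; apply: contrapT => /psi0/eqP; rewrite (negPf psiq).
have W_span q (v : tangent q) : psi q != 0 ->
    exists c : 'rV[R]_n, v = \sum_i c 0 i *: W i q.
  move=> psiq; have [c [-> _]] := e_basis q (psiU q psiq) v.
  exists ((psi q)^-1 *: c); apply: eq_bigr => i _.
  by rewrite mxE /= scalerA mulrAC mulVf// mul1r.
have W_free (c : 'rV[R]_n) : \sum_i c 0 i *: W i p = 0 -> c = 0.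
  move=> c0; have [c' [_ c'_uniq]] := e_basis p Up 0.
  have E : c' = 0 by apply: c'_uniq; rewrite big1// => i _; rewrite mxE scale0r.
  have : c' = psi p *: c.
    apply: c'_uniq; rewrite -[LHS]c0; apply: eq_bigr => i _.
    by rewrite mxE /= scalerA mulrC.
  by rewrite E => /esym/eqP; rewrite scaler_eq0 (negPf psip) => /eqP.
have [f fE] := dual_functions W_free.
pose G : 'M[Cinf M]_n := \matrix_(i, j) vfield_app (W i) (f j).
(* The factor psi makes the expansion of m Z hold also off the frame domain. *)
pose m := psiC * \det G.
exists W, (fun i => lam i p), m; split => //.
- have -> : m p = psi p * Cinf_eval p (\det G) by [].
  rewrite -det_map_mx (_ : map_mx _ G = 1%:M) ?det1 ?mulr1//.
  by apply/matrixP => i j; rewrite !mxE; exact: fE.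
- by move=> i; rewrite op_atE /= linearZ e_eigen//= !scalerA mulrC.
- by move=> v; exact: W_span.
move=> Z; pose z := \row_l vfield_app Z (f l).
exists (fun i => psiC * (z *m \adj G) 0 i); split; last first.
  move=> Zp0 i; rewrite CinfME mxE.
  have -> F : (\sum_j F j : Cinf M) p = Cinf_eval p (\sum_j F j) by [].
  rewrite rmorph_sum big1 ?mulr0// => j _.
  rewrite rmorphM [X in X * _](_ : _ = 0) ?mul0r//.
  by rewrite mxE /= /Cinf_eval /= Zp0.
apply: vfield_at_inj => q; rewrite vfield_sum_at vfield_atZ.
under eq_bigr do rewrite vfield_atZ CinfME.
have [psiq|psiq] := eqVneq (psi q) 0.
  rewrite CinfME /= psiq mul0r scale0r big1// => i _.
  by rewrite mul0r scale0r.
have [c Zq] := W_span q (Z q) psiq.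
have zE : map_mx (Cinf_eval q) z = c *m map_mx (Cinf_eval q) G.
  apply/rowP => l; rewrite !mxE /Cinf_eval /= Zq tangent_sumE.
  by apply: eq_bigr => i _; rewrite !mxE.
rewrite [in LHS]Zq scaler_sumr; apply: eq_bigr => i _; rewrite scalerA; congr (_ *: _).
rewrite CinfME -mulrA; congr (_ * _).
have -> : (z *m \adj G) 0 i q = (map_mx (Cinf_eval q) (z *m \adj G)) 0 i by rewrite !mxE.
rewrite map_mxM map_mx_adj zE -mulmxA mul_mx_adj mul_mx_scalar mxE.
by rewrite -/(Cinf_eval q (\det G)) det_map_mx.
Qed.

Lemma linear_l_sum S k (h : 'I_k -> Cinf M) (W : 'I_k -> vfield M) Y : linear_l S ->
  S (\sum_i h i *: W i) Y = \sum_i h i *: S (W i) Y.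
Proof.
move=> Slin; apply: (big_ind2 (fun X Z => S X Y = Z)) => [|X Z X' Z' <- <-|i _].
- exact: linear_l0.
- exact: linear_lD.
- exact: linear_lZ.
Qed.

(** Tensors are local at points: expand m Z in the frame. *)
Lemma linear_l_vanish A S p W lam m Z Y : eigenframe A p W lam m -> linear_l S ->
  Z p = 0 -> S Z Y p = 0.
Proof.
move=> fr Slin Zp0; have [h [mZ /(_ Zp0) h0]] := eigenframe_expand fr Z.
have : (m *: S Z Y) p = 0.
  rewrite -(linear_lZ _ _ _ Slin) mZ linear_l_sum// vfield_sum_at big1// => i _.
  by rewrite vfield_atZ h0 scale0r.
by move/eqP; rewrite vfield_atZ scaler_eq0 (negPf (eigenframe_neq0 fr)) => /eqP.
Qed.

(** Apply the vanishing to the field A X - a X, with a read as a constant. *)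
Lemma linear_l_eigen A S p W lam m a X Y :
  eigenframe A p W lam m -> linear_l S ->
  A X p = a *: X p -> S (A X) Y p = a *: S X Y p.
Proof.
move=> fr Slin AXp; pose c : Cinf M := - (a *: (1 : Cinf M)).
have cp : c p = - a by rewrite CinfNE /=; congr (- _); exact: mulr1.
have : S (c *: X + A X) Y p = 0.
  apply: linear_l_vanish fr Slin _.
  by rewrite vfield_atD vfield_atZ AXp cp scaleNr addNr.
rewrite Slin vfield_atD vfield_atZ cp scaleNr addrC => /eqP.
by rewrite subr_eq0 => /eqP.
Qed.

(** By tensoriality S(AX, Y) = a S(X, Y) at p, although X is an eigenvector at
    the point p only: S(X, Y)(p) itself is the preimage. *)
Lemma adl_range A S p W lam m a X Y :
  eigenframe A p W lam m -> linear_l S -> A X p = a *: X p ->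
  exists w, adl A S X Y p = op_at A p w - a *: w.
Proof.
move=> fr Slin AXp; exists (S X Y p).
by rewrite -(linear_l_eigen Y fr Slin AXp).
Qed.

Lemma tensor_eq0 A S p W lam m : eigenframe A p W lam m ->
  linear_l S -> linear_l (fun X Y => S Y X) ->
  (forall i j, S (W i) (W j) p = 0) -> forall X Y, S X Y p = 0.
Proof.
move=> fr Sl Sr S0 X Y.
have step T Y' : linear_l T -> (forall i, T (W i) Y' p = 0) -> forall Z, T Z Y' p = 0.
  move=> Tl T0 Z; have [h [mZ _]] := eigenframe_expand fr Z.
  have : (m *: T Z Y') p = 0.
    rewrite -(linear_lZ _ _ _ Tl) mZ linear_l_sum// vfield_sum_at big1// => i _.
    by rewrite vfield_atZ T0 scaler0.
  by move/eqP; rewrite vfield_atZ scaler_eq0 (negPf (eigenframe_neq0 fr)) => /eqP.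
by apply: (step) => // i; apply: (step (fun X Y => S Y X)).
Qed.

Lemma eigenframe_coord A p W lam m a (c d : 'rV[R]_n) :
  eigenframe A p W lam m ->
  \sum_j c 0 j *: W j p = op_at A p (\sum_j d 0 j *: W j p) - a *: \sum_j d 0 j *: W j p ->
  forall j, c 0 j = (lam j - a) * d 0 j.
Proof.
move=> fr cd j.
have : c - \row_j ((lam j - a) * d 0 j) = 0.
  apply: (eigenframe_free fr).
  under eq_bigr do rewrite !mxE scalerBl.
  rewrite sumrB cd linear_sum scaler_sumr -sumrB; apply/eqP; rewrite subr_eq0; apply/eqP.
  apply: eq_bigr => i _.
  have /= Wi := eigenframe_eigen fr i.
  by rewrite linearZ /= Wi !scalerA -scalerBl; congr (_ *: _); ring.
by move=> /rowP/(_ j); rewrite !mxE => /eqP; rewrite subr_eq0 => /eqP.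
Qed.

(** On the component v_c of eigenvalue c the last hypothesis reads
    (c-a)(c-b) v_c = 0; the range hypotheses give v_c = 0 for c = a and c = b. *)
Lemma semisimple_cancel A p W lam m a b (v w1 w2 : tangent p) :
  eigenframe A p W lam m ->
  v = op_at A p w1 - a *: w1 -> v = op_at A p w2 - b *: w2 ->
  (let u := op_at A p v - b *: v in op_at A p u - a *: u = 0) -> v = 0.
Proof.
move=> fr.
have span := eigenframe_span fr.
have [c ->] := span v; have [d1 ->] := span w1; have [d2 ->] := span w2.
move=> /(eigenframe_coord fr) v1 /(eigenframe_coord fr) v2 /=.
have [e uE] := span (op_at A p (\sum_i c 0 i *: W i p) - b *: \sum_i c 0 i *: W i p).
have /(eigenframe_coord fr) v3 := esym uE.
rewrite uE => u0.
have v4 : forall j, 0 = (lam j - a) * e 0 j.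
  move=> j; have := @eigenframe_coord A p W lam m a 0 e fr; rewrite u0 => /(_ _ j).
  by rewrite mxE; apply; rewrite big1// => i _; rewrite mxE scale0r.
rewrite big1// => j _; suff -> : c 0 j = 0 by rewrite scale0r.
have := v4 j; rewrite v3 => /esym/eqP; rewrite !mulf_eq0.
case/or3P => /eqP E; [by rewrite v1 E mul0r|by rewrite v2 E mul0r|by []].
Qed.

(** The component of S(X, Y) at p along the eigenspace of A that contains X(p)
    vanishes; the image of A - a avoids eigenprojections. *)
Definition eigen_range_l A S := forall p a X Y, A X p = a *: X p ->
  exists w, S X Y p = op_at A p w - a *: w.

(** On fields W_i, W_j of an eigenframe, of eigenvalues a and b at p,
    the operator adl A (adr A _) acts on the value of S at p as (A-a)(A-b). *)
Lemma semisimple_reduced A S : semisimple A ->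
  linear_l S -> linear_l (fun X Y => S Y X) ->
  eigen_range_l A S -> eigen_range_l A (fun X Y => S Y X) ->
  (forall X Y, adl A (adr A S) X Y = 0) -> forall X Y, S X Y = 0.
Proof.
move=> ss Sl Sr rl rr S0 X Y; apply: vfield_at_inj => p.
have [W [lam [m fr]]] := semisimple_eigenframe p ss.
apply: (tensor_eq0 fr Sl Sr) => i j.
have Wi := eigenframe_eigen fr i; have Wj := eigenframe_eigen fr j.
have [w1 E1] := rl p _ _ (W j) Wi; have [w2 E2] := rr p _ _ (W i) Wj.
apply: (semisimple_cancel fr E1 E2) => /=.
have := congr1 (fun Z : vfield M => Z p) (S0 (W i) (W j)).
rewrite /adl /adr vfield_atB !op_atE !vfield_atB !op_atE.
have SWi Z : S (A (W i)) Z p = lam i *: S (W i) Z p := linear_l_eigen Z fr Sl Wi.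
have SWj Z : S Z (A (W j)) p = lam j *: S Z (W j) p := linear_l_eigen Z fr Sr Wj.
rewrite !SWj !SWi => E; apply: etrans E.
exact: linear_subZ_comm.
Qed.

Lemma linear_l_flip_mixed_haantjes C1 C2 D1 D2 :
  op_commute C1 D1 -> op_commute C1 D2 -> op_commute C2 D1 -> op_commute C2 D2 ->
  linear_l (fun X Y => mixed_haantjes C1 C2 D1 D2 Y X).
Proof.
move=> C1D1 C1D2 C2D1 C2D2 h X Z Y; rewrite ![mixed_haantjes C1 C2 _ _ _ _]mixed_haantjes_flip//.
by rewrite (@mixed_haantjes_linear_l _ _ _ D1 D2 C1 C2) opprD scalerN.
Qed.

Lemma mixed_haantjes_range_l A C D1 D2 : semisimple A ->
  op_commute A D1 -> op_commute A D2 -> eigen_range_l A (mixed_haantjes A C D1 D2).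
Proof.
move=> ss AD1 AD2 p a X Y AX; have [W [lam [m fr]]] := semisimple_eigenframe p ss.
rewrite mixed_haantjes_adl//; apply: adl_range fr _ AX.
by do 2![apply: linear_l_adr]; exact: adl_lie_linear.
Qed.

(** The mixed torsion is a commutator with A in each argument, which gives the
    ranges; and applying both commutators with A once more gives the commutators
    with C and D of the Haantjes torsion of A. *)
Lemma mixed_haantjes_eq0 A C D : semisimple A -> haantjes A ->
  op_commute A C -> op_commute A D -> op_commute C D ->
  forall X Y, mixed_haantjes A C A D X Y = 0.
Proof.
move=> ss hA AC_ AD CD.
have AA : op_commute A A by [].
have CA := op_commute_sym AC_; have DA := op_commute_sym AD.
apply: (semisimple_reduced ss).
- exact: mixed_haantjes_linear_l.
- exact: linear_l_flip_mixed_haantjes.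
- exact: mixed_haantjes_range_l.
- move=> p a Y X AY; have [w E] := mixed_haantjes_range_l D ss AA AC_ X AY.
  exists (- w); rewrite mixed_haantjes_flip// vfield_atN E.
  by rewrite opprB linearN /= scalerN opprK addrC.
have AAAA0 : mixed_haantjes A A A A = fun _ _ => 0.
  by apply/funext => X; apply/funext => Y; rewrite -haantjes_torsionE hA.
have -> : adl A (adr A (mixed_haantjes A C A D)) = adr D (adl C (mixed_haantjes A A A A)).
  rewrite /mixed_haantjes !(adl_adr _ CA) (adl_swap (adl A _) CA) (adl_swap _ CA).
  by rewrite !(adr_swap _ DA) !(adl_adr _ AA) (adl_adr _ AD).
by move=> X Y; rewrite AAAA0 /adr /adl !(linear0, subr0).
Qed.

(** Of the mixed torsions with letters A and B, only those with equal letters on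
    each side and different letters on the two sides survive. *)
Lemma haantjes_torsion_comb A B f g X Y : semisimple A -> semisimple B ->
  haantjes A -> haantjes B -> op_commute A B ->
  haantjes_torsion (op_comb f A g B) X Y =
    (f * f * g * g) *: haantjes_bracket A B X Y.
Proof.
move=> sA sB hA hB AB; have BA := op_commute_sym AB.
have AA : op_commute A A by [].
have BB : op_commute B B by [].
rewrite haantjes_torsionE mixed_haantjes_double_l// !mixed_haantjes_double_r//.
rewrite haantjes_bracketE//.
rewrite (mixed_haantjes_eq0 sA hA AA AA AA) (mixed_haantjes_eq0 sB hB BB BB BB).
rewrite (mixed_haantjes_eq0 sA hA AB AB BB) (mixed_haantjes_eq0 sA hA AA AB AB).
rewrite (mixed_haantjes_eq0 sA hA AB AA BA).
rewrite (mixed_haantjes_swapr _ _ AB) (mixed_haantjes_eq0 sB hB BB BA BA).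
rewrite (mixed_haantjes_swapl _ _ AB) (mixed_haantjes_eq0 sB hB BA BB AB).
rewrite !scaler0 !addr0 !add0r !scaler0 !addr0 !scalerDr !scalerA.
by rewrite (_ : g * g * f * f = f * f * g * g)//; ring.
Qed.

End Eigenframes.

Theorem theorem23 (R : realType) (n : nat) (M : manifold R n)
    (A B : operator M)
    (A_semisimple : semisimple A) (B_semisimple : semisimple B)
    (A_haantjes : haantjes A) (B_haantjes : haantjes B)
    (AB_commute : forall X : vfield M, A (B X) = B (A X)) :
  haantjes_module A B <->
  forall X Y : vfield M, haantjes_bracket A B X Y = 0.
Proof.
have E f g X Y := haantjes_torsion_comb f g X Y A_semisimple B_semisimple
  A_haantjes B_haantjes AB_commute.
split=> [AB X Y|AB f g X Y]; last by rewrite E AB scaler0.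
by have := AB 1 1 X Y; rewrite E !mulr1 scale1r.
Qed.
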